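(* There exists no almost rational golden $(\alpha,\beta)$-metric.
   Context: Let $M$ be a smooth manifold of finite dimension $n$, $\alpha=\sqrt{\alpha_{ij}(x)y^iy^j}$ a Riemannian metric and $\beta=b_i(x)y^i$ a $1$-form on $M$. The golden $(\alpha,\beta)$-metric is $F=\alpha\,\phi(s)$ with $\phi(s)=s^2-s-1$ and $s=\beta/\alpha$. With $b=\|\beta\|_\alpha>1/\sqrt2$ and $k=\sqrt{(2b^2-1)/3}$, it is regarded as a Finsler metric on the open subset of the slit tangent bundle where $s\in\left(-k,\frac{1-\sqrt5}{2}\right)\cup\left(\frac{1+\sqrt5}{2},k\right)$, that is, where $\phi(s)>0$ and $2b^2-3s^2-1>0$. A Finsler metric $F$ on $M$ is almost rational if the components $g_{ij}(x,y)=\frac12\frac{\partial^2F^2}{\partial y^i\partial y^j}$ of its metric tensor can be expressed in the form $g_{ij}(x,y)=\eta(x,y)\,a_{ij}(x,y)$, where (a) $\eta:TM\to(0,\infty)$ is a smooth function; (b) the matrix $(a_{ij}(x,y))_{1\le i,j\le n}$ is symmetric and positive definite; (c) for each $i,j$, $a_{ij}(x,y)$ is a rational function of the fiber coordinate $y$. For the golden $(\alpha,\beta)$-metric these conditions are understood on its domain. *)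

(* Defs.v *)
From mathcomp Require Import all_boot all_order all_algebra.
From mathcomp Require Import all_classical all_reals all_analysis.
From mathcomp Require mpoly.

Set Implicit Arguments.
Unset Strict Implicit.
Unset Printing Implicit Defensive.

Import Order.TTheory GRing.Theory Num.Theory.
Import numFieldNormedType.Exports.

Local Open Scope classical_set_scope.
Local Open Scope ring_scope.

(* Vectors of R^n, coordinates of points and of tangent vectors, and components
   of covectors are all row vectors. *)

Definition partial (R : realType) (n : nat) (i : 'I_n) (f : 'rV[R]_n -> R)
    (x : 'rV[R]_n) : R :=
  'D_(delta_mx 0 i) f x.

Definition iter_partial (R : realType) (n : nat) (s : seq 'I_n)
    (f : 'rV[R]_n -> R) : 'rV[R]_n -> R :=
  foldr (@partial R n) f s.

(* f is C^oo on U; only used for open sets U. *)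
Definition smooth_on (R : realType) (n : nat) (U : set 'rV[R]_n)
    (f : 'rV[R]_n -> R) : Prop :=
  forall (s : seq 'I_n) (x : 'rV[R]_n), U x ->
    {for x, continuous (iter_partial s f)} /\
    forall i : 'I_n, derivable (iter_partial s f) x (delta_mx 0 i).

(* The atlas is not required to be maximal. [chart_inv c] is meaningful only on
   the image of [chart c]. *)
Record manifold (R : realType) (n : nat) := Manifold {
  space :> topologicalType;
  space_hausdorff : hausdorff_space space;
  space_second_countable : @second_countable space;
  index : Type;
  chart_dom : index -> set space;
  chart : index -> space -> 'rV[R]_n;
  chart_inv : index -> 'rV[R]_n -> space;
  chart_dom_open : forall c, open (chart_dom c);
  chart_image_open : forall c, open (chart c @` chart_dom c);
  chartK : forall c, {in chart_dom c, cancel (chart c) (chart_inv c)};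
  chart_continuous : forall c, {within chart_dom c, continuous (chart c)};
  chart_inv_continuous : forall c,
    {within chart c @` chart_dom c, continuous (chart_inv c)};
  chart_cover : forall p, exists c, chart_dom c p;
  transition_smooth : forall (c d : index) (i : 'I_n),
    smooth_on (chart c @` (chart_dom c `&` chart_dom d))
              (fun x => chart d (chart_inv c x) 0 i)
}.

Definition chart_image (R : realType) (n : nat) (M : manifold R n)
    (c : index M) : set 'rV[R]_n :=
  chart c @` chart_dom c.

Definition overlap (R : realType) (n : nat) (M : manifold R n)
    (c d : index M) : set 'rV[R]_n :=
  chart c @` (chart_dom c `&` chart_dom d).

Definition transition (R : realType) (n : nat) (M : manifold R n)
    (c d : index M) (x : 'rV[R]_n) : 'rV[R]_n :=
  chart d (chart_inv c x).

(* TM is the gluing of the sets (chart_image c) * R^n along the identifications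
   (c, x, y) ~ (d, transition c d x, y *m 'J (transition c d) x), where x lies
   in [overlap c d]. Accordingly a subset of TM is a family of predicates, and a
   real function on such a subset a family of functions of (x, y), both indexed
   by the charts and invariant under these identifications. *)
Definition tangent_set (R : realType) (n : nat) (M : manifold R n) : Type :=
  index M -> 'rV[R]_n -> 'rV[R]_n -> Prop.

Definition tangent_fun (R : realType) (n : nat) (M : manifold R n) : Type :=
  index M -> 'rV[R]_n -> 'rV[R]_n -> R.

Definition tangent_invariant (R : realType) (n : nat) (M : manifold R n)
    (D : tangent_set M) (f : tangent_fun M) : Prop :=
  forall (c d : index M) (x y : 'rV[R]_n), overlap c d x -> D c x y ->
    f d (transition c d x) (y *m 'J (transition c d) x) = f c x y.

Definition tangent_smooth (R : realType) (n : nat) (M : manifold R n)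
    (D : tangent_set M) (f : tangent_fun M) : Prop :=
  forall c : index M,
    smooth_on [set z : 'rV[R]_(n + n) | D c (lsubmx z) (rsubmx z)]
              (fun z => f c (lsubmx z) (rsubmx z)).

Definition quad (R : realType) (n : nat) (A : 'M[R]_n) (y : 'rV[R]_n) : R :=
  (y *m A *m y^T) 0 0.

Definition sym_posdef (R : realType) (n : nat) (A : 'M[R]_n) : Prop :=
  A^T = A /\ forall y : 'rV[R]_n, y != 0 -> 0 < quad A y.

Record riemannian (R : realType) (n : nat) (M : manifold R n) := Riemannian {
  metric_comp : index M -> 'rV[R]_n -> 'M[R]_n;
  metric_smooth : forall (c : index M) (i j : 'I_n),
    smooth_on (chart_image c) (fun x => metric_comp c x i j);
  metric_posdef : forall (c : index M) (x : 'rV[R]_n),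
    chart_image c x -> sym_posdef (metric_comp c x);
  metric_tensorial : forall (c d : index M) (x : 'rV[R]_n), overlap c d x ->
    metric_comp c x =
      'J (transition c d) x *m metric_comp d (transition c d x)
        *m ('J (transition c d) x)^T
}.

Record one_form (R : realType) (n : nat) (M : manifold R n) := OneForm {
  form_comp : index M -> 'rV[R]_n -> 'rV[R]_n;
  form_smooth : forall (c : index M) (i : 'I_n),
    smooth_on (chart_image c) (fun x => form_comp c x 0 i);
  form_tensorial : forall (c d : index M) (x : 'rV[R]_n), overlap c d x ->
    form_comp c x =
      form_comp d (transition c d x) *m ('J (transition c d) x)^T
}.

Definition riemannian_norm (R : realType) (n : nat) (M : manifold R n)
    (alpha : riemannian M) : tangent_fun M :=
  fun c x y => Num.sqrt (quad (metric_comp alpha c x) y).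

Definition form_eval (R : realType) (n : nat) (M : manifold R n)
    (beta : one_form M) : tangent_fun M :=
  fun c x y => (y *m (form_comp beta c x)^T) 0 0.

(* ||beta||_alpha at the point of coordinates x: the square root of
   alpha^{ij} b_i b_j *)
Definition form_norm (R : realType) (n : nat) (M : manifold R n)
    (alpha : riemannian M) (beta : one_form M) (c : index M)
    (x : 'rV[R]_n) : R :=
  Num.sqrt (quad (invmx (metric_comp alpha c x)) (form_comp beta c x)).

Definition slope (R : realType) (n : nat) (M : manifold R n)
    (alpha : riemannian M) (beta : one_form M) : tangent_fun M :=
  fun c x y => form_eval beta c x y / riemannian_norm alpha c x y.

Definition golden_phi (R : realType) (s : R) : R := s ^+ 2 - s - 1.

Definition golden_fun (R : realType) (n : nat) (M : manifold R n)
    (alpha : riemannian M) (beta : one_form M) : tangent_fun M :=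
  fun c x y =>
    riemannian_norm alpha c x y * golden_phi (slope alpha beta c x y).

Definition golden_radius (R : realType) (b : R) : R :=
  Num.sqrt ((2 * b ^+ 2 - 1) / 3).

Definition golden_set (R : realType) (n : nat) (M : manifold R n)
    (alpha : riemannian M) (beta : one_form M) : tangent_set M :=
  fun c x y =>
    let k := golden_radius (form_norm alpha beta c x) in
    let s := slope alpha beta c x y in
    [/\ chart_image c x, y != 0 &
        (- k < s < (1 - Num.sqrt 5) / 2) \/ ((1 + Num.sqrt 5) / 2 < s < k)].

(* The last field excludes the degenerate case of a metric with empty domain,
   which 1 / sqrt 2 < ||beta||_alpha alone does not prevent. *)
Record golden_metric (R : realType) (n : nat) (M : manifold R n) :=
    GoldenMetric {
  golden_alpha : riemannian M;
  golden_beta : one_form M;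
  golden_norm_gt : forall (c : index M) (x : 'rV[R]_n), chart_image c x ->
    1 / Num.sqrt 2 < form_norm golden_alpha golden_beta c x;
  golden_set_neq0 : exists (c : index M) (x y : 'rV[R]_n),
    golden_set golden_alpha golden_beta c x y
}.

Definition golden_domain (R : realType) (n : nat) (M : manifold R n)
    (G : golden_metric M) : tangent_set M :=
  golden_set (golden_alpha G) (golden_beta G).

Definition golden_F (R : realType) (n : nat) (M : manifold R n)
    (G : golden_metric M) : tangent_fun M :=
  golden_fun (golden_alpha G) (golden_beta G).

Definition fundamental_tensor (R : realType) (n : nat) (M : manifold R n)
    (F : tangent_fun M) (c : index M) (x y : 'rV[R]_n) : 'M[R]_n :=
  \matrix_(i, j) (1 / 2 * partial i (partial j (fun z => F c x z ^+ 2)) y).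

Definition rational_on (R : realType) (n : nat) (A : set 'rV[R]_n)
    (f : 'rV[R]_n -> R) : Prop :=
  exists P Q : mpoly.mpoly n R, forall y : 'rV[R]_n, A y ->
    mpoly.meval (y 0) Q != 0 /\
    f y = mpoly.meval (y 0) P / mpoly.meval (y 0) Q.

Definition almost_rational (R : realType) (n : nat) (M : manifold R n)
    (D : tangent_set M) (F : tangent_fun M) : Prop :=
  exists (eta : tangent_fun M) (a : index M -> 'rV[R]_n -> 'rV[R]_n -> 'M[R]_n),
    [/\ [/\ tangent_invariant D eta, tangent_smooth D eta &
            forall c x y, D c x y -> 0 < eta c x y],
        forall c x y, D c x y -> sym_posdef (a c x y),
        forall c x i j, rational_on [set y | D c x y] (fun y => a c x y i j) &
        forall c x y, D c x y ->
          fundamental_tensor F c x y = eta c x y *: a c x y].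

(* Main.v *)
Require Import Defs.
From mathcomp Require Import all_boot all_order all_algebra.
From mathcomp Require Import all_classical all_reals all_analysis.
From mathcomp Require mpoly.
From mathcomp Require Import ring lra zify.

(** Fix a tangent space, a vector y of the domain, and v <> 0 with beta(v) = 0;
    such a v exists because s^2 < ||b||^2 prevents y from being proportional to
    the dual vector of beta. Along the line y + t v the 1-form is a nonzero
    constant c, while q(t) = alpha^2 is a quadratic polynomial without real
    root. If g = eta a, then g(y,v) a(y,y) = g(y,y) a(y,v), where by Euler's
    theorem g(y,y) = F^2 and 2 g(y,v) is the derivative of F^2 along v. Both are
    of the form (rational) + sqrt(q) (rational) in t, and a(y,y), a(y,v) are
    rational in t. As sqrt(q) is not rational, the rational and the irrational
    parts vanish separately, and eliminating a gives the impossible polynomial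
    identity q^2 - 3 c^2 q + c^4 = 0. *)

Set Implicit Arguments.
Unset Strict Implicit.
Unset Printing Implicit Defensive.

Import Order.TTheory GRing.Theory Num.Theory.
Import numFieldNormedType.Exports.

Local Open Scope classical_set_scope.
Local Open Scope ring_scope.

(** * Directional derivatives of real-valued functions *)

Section DirectionalDerivatives.
Variables (R : realType) (V : normedModType R).
Implicit Types (f g : V -> R) (x v : V).

(** Both sides are limits of the same difference quotient, so one-variable rules, such as that of
    the square root, apply along lines. *)
Lemma is_derive_lineP f x v (df : R) :
  is_derive x v f df <-> is_derive (0 : R) 1 (fun h : R => f (h *: v + x)) df.
Proof.
have E : 'D_v f x = 'D_1 (fun h : R => f (h *: v + x)) 0.
  rewrite /derive; set g1 := fun h => h^-1 *: _; set g2 := fun h => h^-1 *: _.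
  suff -> : g1 = g2 by [].
  by rewrite funeqE /g1 /g2 => h /=; rewrite addr0 scale0r add0r [_%:A]mulr1.
split=> -[d e]; apply: DeriveDef.
- exact: (derivable1P f x v).1.
- by rewrite -E.
- exact: (derivable1P f x v).2.
- by rewrite E.
Qed.

Lemma is_derive_sqrt f x v (df : R) : 0 < f x -> is_derive x v f df ->
  is_derive x v (fun z => Num.sqrt (f z)) (df / (2 * Num.sqrt (f x))).
Proof.
move=> fx0 /is_derive_lineP dfx; apply/is_derive_lineP.
have f0 : 0 < (fun h : R => f (h *: v + x)) 0 by rewrite scale0r add0r.
have := is_derive1_comp (is_derive1_sqrt f0) dfx.
by rewrite /= scale0r add0r mulrC.
Qed.

Lemma is_derive_inv f x v (df : R) : f x != 0 -> is_derive x v f df ->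
  is_derive x v (fun z => (f z)^-1) (- (f x) ^- 2 * df).
Proof.
move=> fx0 [d e]; apply: DeriveDef; first exact: derivableV.
by rewrite deriveV// e.
Qed.

Lemma is_derive_mul f g x v (df dg : R) :
  is_derive x v f df -> is_derive x v g dg ->
  is_derive x v (fun z => f z * g z) (df * g x + f x * dg).
Proof.
move=> hf hg; apply: (is_derive_eq (is_deriveM hf hg)).
by rewrite addrC [g x *: _]mulrC.
Qed.

Lemma is_derive_add f g x v (df dg : R) :
  is_derive x v f df -> is_derive x v g dg ->
  is_derive x v (fun z => f z + g z) (df + dg).
Proof. by move=> hf hg; exact: is_deriveD. Qed.

Lemma is_derive_opp f x v (df : R) :
  is_derive x v f df -> is_derive x v (fun z => - f z) (- df).
Proof. by move=> hf; exact: is_deriveN. Qed.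

Lemma is_derive_const (k : R) x v : is_derive x v (fun=> k) 0.
Proof. exact: is_derive_cst. Qed.

Lemma is_derive_exp f k x v (df : R) : is_derive x v f df ->
  is_derive x v (fun z => f z ^+ k) (k%:R * f x ^+ k.-1 * df).
Proof. by move=> hf; have := is_deriveX k hf; rewrite exprfctE. Qed.

End DirectionalDerivatives.

(** * Bilinear forms, covectors and their derivatives *)

Section Quadratic.
Variables (R : realType) (n : nat) (A : 'M[R]_n) (b : 'rV[R]_n).
Implicit Types x y u v z : 'rV[R]_n.

Definition bil x y : R := (x *m A *m y^T) 0 0.
Definition covec (c : 'rV[R]_n) y : R := (y *m c^T) 0 0.

Lemma quadE x : quad A x = bil x x.
Proof. by []. Qed.

Lemma bilDl x y z : bil (x + y) z = bil x z + bil y z.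
Proof. by rewrite /bil !mulmxDl mxE. Qed.

Lemma bilDr x y z : bil z (x + y) = bil z x + bil z y.
Proof. by rewrite /bil linearD /= !mulmxDr mxE. Qed.

Lemma bilZl h x y : bil (h *: x) y = h * bil x y.
Proof. by rewrite /bil -!scalemxAl mxE. Qed.

Lemma bilZr h x y : bil x (h *: y) = h * bil x y.
Proof. by rewrite /bil linearZ /= -!scalemxAr mxE. Qed.

Lemma covecD c x y : covec c (x + y) = covec c x + covec c y.
Proof. by rewrite /covec !mulmxDl mxE. Qed.

Lemma covecZ c h x : covec c (h *: x) = h * covec c x.
Proof. by rewrite /covec -!scalemxAl mxE. Qed.

Hypothesis symA : A^T = A.

Lemma bilC x y : bil x y = bil y x.
Proof.
have E : y *m A *m x^T = (x *m A *m y^T)^T.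
  by rewrite !trmx_mul trmxK symA mulmxA.
by rewrite /bil E [RHS]mxE.
Qed.

Lemma is_derive_covec c x v : is_derive x v (covec c) (covec c v).
Proof.
apply/is_derive_lineP.
rewrite (_ : (fun h : R => _) =
  (fun h : R => h * covec c v + covec c x)); last first.
  by apply/funext => h; rewrite covecD covecZ.
apply: (is_derive_eq (is_derive_add (is_derive_mul (is_derive_id _ _)
  (is_derive_const _ _ _)) (is_derive_const _ _ _))).
by rewrite mulr0 !addr0 mul1r.
Qed.

Lemma is_derive_bil u x v : is_derive x v (fun z => bil z u) (bil v u).
Proof.
have E z : bil z u = covec (u *m A^T) z.
  by rewrite /bil /covec trmx_mul trmxK mulmxA.
rewrite E (_ : (fun z => _) = covec (u *m A^T)); last by apply/funext.
exact: is_derive_covec.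
Qed.

Lemma is_derive_quad x v : is_derive x v (quad A) (2 * bil x v).
Proof.
apply/is_derive_lineP.
rewrite (_ : (fun h : R => _) =
  (fun h : R => h * (h * bil v v) + (h * (2 * bil x v) + bil x x))); last first.
  apply/funext => h; rewrite quadE bilDl !bilDr !bilZl !bilZr (bilC v x).
  by ring.
apply: (is_derive_eq (is_derive_add (is_derive_mul (is_derive_id _ _)
  (is_derive_mul (is_derive_id _ _) (is_derive_const _ _ _)))
  (is_derive_add (is_derive_mul (is_derive_id _ _)
  (is_derive_const _ _ _)) (is_derive_const _ _ _)))).
by rewrite !mul0r !mulr0 !addr0 !mul1r add0r.
Qed.

End Quadratic.

(** * F^2 on one tangent space: derivatives and Euler's theorem *)

Section GoldenEnergy.
Variables (R : realType) (n : nat) (A : 'M[R]_n) (b : 'rV[R]_n).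
Implicit Types x y u v z : 'rV[R]_n.
Hypothesis posA : sym_posdef A.

Let al z : R := Num.sqrt (quad A z).
Let be z : R := covec b z.
Definition energy z : R := (al z * golden_phi (be z / al z)) ^+ 2.

(* Writing F^2 = H(alpha^2, beta), [energy_q] is twice the derivative of H in
   the first variable and [energy_b] its derivative in the second one. *)
Definition energy_q z : R :=
  2 - 2 * be z ^+ 4 * (al z)^-1 ^+ 4 + 2 * be z * (al z)^-1
    + 2 * be z ^+ 3 * (al z)^-1 ^+ 3.
Definition energy_b z : R :=
  4 * be z ^+ 3 * (al z)^-1 ^+ 2 - 2 * be z + 2 * al z
    - 6 * be z ^+ 2 * (al z)^-1.

Lemma al_gt0 z : z != 0 -> 0 < al z.
Proof. by move=> z0; rewrite sqrtr_gt0; case: posA => _; exact. Qed.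

Lemma sqr_al z : z != 0 -> al z ^+ 2 = quad A z.
Proof. by move=> z0; rewrite sqr_sqrtr// ltW//; case: posA => _; exact. Qed.

Lemma near_neq0 x : x != 0 -> \forall z \near x, z != 0.
Proof. by move=> x0; apply: (@cvgr_neq0 _ _ _ (nbhs x) _ id x). Qed.

Lemma energyE z : z != 0 ->
  energy z = be z ^+ 4 * (al z)^-1 ^+ 2 - be z ^+ 2 + al z ^+ 2
             + 2 * al z * be z - 2 * be z ^+ 3 * (al z)^-1.
Proof.
move=> /al_gt0/lt0r_neq0 a0; rewrite /energy /golden_phi.
by field.
Qed.

Lemma is_derive_al x v : x != 0 -> is_derive x v al (bil A x v * (al x)^-1).
Proof.
move=> x0; have [symA pA] := posA.
apply: (is_derive_eq (is_derive_sqrt (pA _ x0) (is_derive_quad symA x v))).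
have := lt0r_neq0 (al_gt0 x0); rewrite -/(al x) => a0.
by field.
Qed.

Lemma is_derive_alV x v : x != 0 ->
  is_derive x v (fun z => (al z)^-1) (- bil A x v * (al x)^-1 ^+ 3).
Proof.
move=> x0; have a0 := lt0r_neq0 (al_gt0 x0).
apply: (is_derive_eq (is_derive_inv a0 (is_derive_al v x0))).
by field.
Qed.

Lemma is_derive_energy x v : x != 0 ->
  is_derive x v energy (energy_q x * bil A x v + energy_b x * covec b v).
Proof.
move=> x0; have a0 := lt0r_neq0 (al_gt0 x0).
have da := is_derive_al v x0; have dV := is_derive_alV v x0.
have db := is_derive_covec b x v.
have dc (k : R) := is_derive_const k x v.
(* The expansion [energyE] holds off the origin only, hence near [x], which is enough for a
   derivative at [x]. *)
apply: near_eq_is_derive.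
  by near=> z; apply/esym/energyE; near: z; exact: near_neq0.
apply: (is_derive_eq (is_derive_add (is_derive_add (is_derive_add (is_derive_add
  (is_derive_mul (is_derive_exp 4 db) (is_derive_exp 2 dV))
  (is_derive_opp (is_derive_exp 2 db)))
  (is_derive_exp 2 da))
  (is_derive_mul (is_derive_mul (dc 2) da) db))
  (is_derive_opp
    (is_derive_mul (is_derive_mul (dc 2) (is_derive_exp 3 db)) dV)))).
by rewrite /energy_q /energy_b /= -/(be x) -/(be v); field.
Unshelve. all: by end_near.
Qed.

(** With F^2 = H(q, beta), q = alpha^2, and subscripts for partial derivatives, these are 4 H_qq, 2
    H_qb and H_bb. *)
Let c1 x : R := 8 * be x ^+ 4 * (al x)^-1 ^+ 6 - 2 * be x * (al x)^-1 ^+ 3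
  - 6 * be x ^+ 3 * (al x)^-1 ^+ 5.
Let c2 x : R := 2 * (al x)^-1 + 6 * be x ^+ 2 * (al x)^-1 ^+ 3
  - 8 * be x ^+ 3 * (al x)^-1 ^+ 4.
Let c3 x : R := 12 * be x ^+ 2 * (al x)^-1 ^+ 2 - 2 - 12 * be x * (al x)^-1.

Lemma derive2_energy x u v : x != 0 ->
  'D_u (fun z => 'D_v energy z) x =
  c1 x * bil A x u * bil A x v
  + c2 x * (be u * bil A x v + bil A x u * be v)
  + energy_q x * bil A u v + c3 x * be u * be v.
Proof.
move=> x0; have a0 := lt0r_neq0 (al_gt0 x0).
have da := is_derive_al u x0; have dV := is_derive_alV u x0.
have db := is_derive_covec b x u.
have dc (k : R) := is_derive_const k x u.
rewrite (near_eq_derive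
  (g := fun z => energy_q z * bil A z v + energy_b z * covec b v)).
  2: { near=> z; apply: (@derive_val _ _ _ _ _ _ _ (is_derive_energy v _)).
       by near: z; exact: near_neq0. }
apply: derive_val.
apply: (is_derive_eq (is_derive_add
  (is_derive_mul
    (is_derive_add (is_derive_add (is_derive_add (dc 2)
      (is_derive_opp (is_derive_mul (is_derive_mul (dc 2) (is_derive_exp 4 db))
         (is_derive_exp 4 dV))))
      (is_derive_mul (is_derive_mul (dc 2) db) dV))
      (is_derive_mul (is_derive_mul (dc 2) (is_derive_exp 3 db))
        (is_derive_exp 3 dV)))
    (is_derive_bil A v x u))
  (is_derive_mul
    (is_derive_add (is_derive_add (is_derive_add
      (is_derive_mul (is_derive_mul (dc 4) (is_derive_exp 3 db))
        (is_derive_exp 2 dV))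
      (is_derive_opp (is_derive_mul (dc 2) db)))
      (is_derive_mul (dc 2) da))
      (is_derive_opp
        (is_derive_mul (is_derive_mul (dc 6) (is_derive_exp 2 db)) dV)))
    (dc (covec b v))))).
rewrite /energy_q /energy_b /c1 /c2 /c3 /= -/(be x) -/(be u) -/(be v).
by field.
Unshelve. all: by end_near.
Qed.

(** The fundamental tensor g in a fixed tangent space, convertible to [fundamental_tensor] of
    [golden_F]. *)
Definition energy_hess x : 'M[R]_n :=
  \matrix_(i, j) (1 / 2 * partial i (partial j energy) x).

Lemma energy_hessE x : x != 0 ->
  2 *: energy_hess x =
   c1 x *: ((x *m A)^T *m (x *m A))
   + c2 x *: (b^T *m (x *m A) + (x *m A)^T *m b)
   + energy_q x *: A + c3 x *: (b^T *m b).
Proof.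
move=> x0; have [symA _] := posA.
have D (w : 'rV[R]_n) i : (w *m (delta_mx 0 i : 'rV[R]_n)^T) 0 0 = w 0 i.
  by rewrite trmx_delta -colE mxE.
have B i : bil A x (delta_mx 0 i) = (x *m A) 0 i by exact: D.
have b0 i : be (delta_mx 0 i) = b 0 i.
  by rewrite /be /covec -rowE !mxE.
have BB i j : bil A (delta_mx 0 i) (delta_mx 0 j) = A i j.
  by rewrite /bil D -rowE mxE.
apply/matrixP => i j; rewrite mxE /energy_hess mxE /partial derive2_energy//.
rewrite !B !b0 BB.
have T (p q : 'rV[R]_n) : (p^T *m q) i j = p 0 i * q 0 j.
  by rewrite mxE big_ord1 mxE.
have DD (p q : 'M[R]_n) : (p + q) i j = p i j + q i j by rewrite mxE.
have ZZ k (p : 'M[R]_n) : (k *: p) i j = k * p i j by rewrite mxE.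
rewrite !(DD, ZZ) !T.
by field.
Qed.

(** Euler's theorem for the derivative of [energy] along [v], homogeneous of degree 1 in [x]; the
    proof contracts the explicit Hessian with [x]. *)
Lemma euler_hess x v : x != 0 ->
  (x *m energy_hess x *m v^T) 0 0 =
  1 / 2 * (energy_q x * bil A x v + energy_b x * covec b v).
Proof.
move=> x0; have a0 := lt0r_neq0 (al_gt0 x0); have [symA _] := posA.
have E : 2 * (x *m energy_hess x *m v^T) 0 0 =
  energy_q x * bil A x v + energy_b x * covec b v.
  have -> : 2 * (x *m energy_hess x *m v^T) 0 0 =
      (x *m (2 *: energy_hess x) *m v^T) 0 0.
    by rewrite -scalemxAr -scalemxAl [RHS]mxE.
  rewrite energy_hessE//.
  have DD (p q : 'M[R]_n) : (x *m (p + q) *m v^T) 0 0 =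
      (x *m p *m v^T) 0 0 + (x *m q *m v^T) 0 0.
    by rewrite mulmxDr mulmxDl mxE.
  have ZZ k (p : 'M[R]_n) : (x *m (k *: p) *m v^T) 0 0 =
      k * (x *m p *m v^T) 0 0.
    by rewrite -scalemxAr -scalemxAl mxE.
  have T (p q : 'rV[R]_n) : (x *m (p^T *m q) *m v^T) 0 0 =
      covec p x * covec v q.
    by rewrite !mulmxA -(mulmxA _ q) mxE big_ord1.
  have xx : covec (x *m A) x = al x ^+ 2.
    by rewrite sqr_al// /quad /covec trmx_mul symA mulmxA.
  have pvb : covec v b = covec b v.
    by rewrite /covec -[b]trmxK -trmx_mul trmxK [LHS]mxE.
  rewrite !(DD, ZZ) !T xx pvb -/(bil A x v) -[covec v (x *m A)]/(bil A x v).
  rewrite -/(be x) /energy_q /energy_b /c1 /c2 /c3.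
  by field.
lra.
Qed.

(** Euler's theorem in degree 2; combined with [euler_hess] at [v = x] it gives g(x, x) = F^2. *)
Lemma energy_euler x : x != 0 ->
  energy x = 1 / 2 * (energy_q x * bil A x x + energy_b x * covec b x).
Proof.
move=> x0; have a0 := lt0r_neq0 (al_gt0 x0).
rewrite energyE// -[bil A x x]/(quad A x) -sqr_al// -/(be x).
rewrite /energy_q /energy_b.
by field.
Qed.

End GoldenEnergy.

(** * Polynomial algebra: irrationality of sqrt(q) and the elimination *)

(** Infinite descent: the irreducible [q] divides [X], say X = Z q, and then Y^2 = q Z^2 is a
    solution of the same shape with smaller total size. *)
Lemma sqr_eq_irreducible_mul (F : fieldType) (q X Y : {poly F}) :
  irreducible_poly q -> X ^+ 2 = q * Y ^+ 2 -> X = 0 /\ Y = 0.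
Proof.
move=> irr_q; have q0 := irredp_neq0 irr_q; have [q1 _] := irr_q.
have [m] := ubnP (size X + size Y); elim: m X Y => // m IH X Y le_m XY.
have [X0|X0] := eqVneq X 0.
  split=> //; move/esym/eqP: XY.
  by rewrite X0 expr0n /= mulf_eq0 (negPf q0) expf_eq0 => /eqP.
have qX : q %| X.
  apply: contraT => nqX.
  have cop : coprimep q X by rewrite irreducible_poly_coprime.
  have : q %| X * X by rewrite -expr2 XY dvdp_mulr.
  by rewrite Gauss_dvdpr// (negPf nqX).
have [Z XZ] : exists Z : {poly F}, X = Z * q by apply/dvdpP.
have Z0 : Z != 0 by apply: contraNneq X0 => Z0; rewrite XZ Z0 mul0r.
have YZ : Y ^+ 2 = q * Z ^+ 2.
  by apply: (mulfI q0); rewrite -XY XZ; ring.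
have [|_ ZE] := IH Y Z _ YZ; last by rewrite ZE eqxx in Z0.
move: le_m q1; rewrite XZ size_mul//.
by move: (size Y) (size Z) (size q) => *; lia.
Qed.

Lemma poly_near0 (R : realType) (p : {poly R}) :
  (\forall t \near (0 : R), p.[t] = 0) -> p = 0.
Proof.
move=> /nbhs_ballP[e /= e0 He]; apply/eqP; apply: contraT => p0.
(* As many distinct roots as the size of [p], one more than its degree. The shift by 2 keeps even
   the point for k = 0 strictly inside the ball. *)
pose s := [seq e / (k%:R + 2) | k <- iota 0 (size p)].
suff : (size s < size p)%N by rewrite size_map size_iota ltnn.
apply: max_poly_roots => //.
- apply/allP => _ /mapP[k _ ->]; apply/rootP/He.
  rewrite /ball /= sub0r normrN ger0_norm ?divr_ge0 ?ltW//.
  rewrite ltr_pdivrMr; have := ler0n R k; nra.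
- rewrite map_inj_uniq ?iota_uniq// => i j.
  move=> /(mulfI (lt0r_neq0 e0))/invr_inj/addIr/eqP.
  by rewrite eqr_nat => /eqP.
Qed.

(** The equation is 2 g(y,v) a(y,y) = 2 g(y,y) a(y,v) on a line where beta = [c] and alpha^2 = [q],
    with denominators cleared: [K] carries a(y,y) times the A-product of y and v, [N] carries
    a(y,v). *)
Lemma no_rational_ratio (R : realType) (q K N : {poly R}) (c : R) :
  irreducible_poly q -> c != 0 -> K != 0 ->
  (\forall t \near (0 : R), 0 < q.[t] /\ let a := Num.sqrt q.[t] in
    (2 - 2 * c ^+ 4 * a^-1 ^+ 4 + 2 * c * a^-1 + 2 * c ^+ 3 * a^-1 ^+ 3) * K.[t]
    = 2 * (c ^+ 4 * a^-1 ^+ 2 - c ^+ 2 + a ^+ 2 + 2 * a * c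
             - 2 * c ^+ 3 * a^-1) * N.[t]) -> False.
Proof.
move=> irr_q c0 K0 H; have q0 := irredp_neq0 irr_q; have [q1 _] := irr_q.
(* Multiplied by a^4 / 2, the hypothesis reads X + a Y = 0. *)
pose C := c%:P; have C0 : C != 0 by rewrite polyC_eq0.
pose X := K * (q ^+ 2 - C ^+ 4) - N * q * (q ^+ 2 - C ^+ 2 * q + C ^+ 4).
pose Y := K * C * (q + C ^+ 2) - 2 * C * N * q * (q - C ^+ 2).
have XY : X ^+ 2 - q * Y ^+ 2 = 0.
  apply: poly_near0; apply: filterS H => t [qt].
  have : Num.sqrt q.[t] ^+ 2 = q.[t] by rewrite sqr_sqrtr// ltW.
  have : 0 < Num.sqrt q.[t] by rewrite sqrtr_gt0.
  set a := Num.sqrt _ => /lt0r_neq0 a0 aq /= E.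
  have EE : X.[t] = - a * Y.[t].
    rewrite /X /Y !hornerE -aq.
    move/eqP: E; rewrite -subr_eq0 => /eqP/(congr1 ( *%R (a ^+ 4 / 2))).
    rewrite mulr0 => E; apply/eqP; rewrite -subr_eq0 -[X in _ == X]E.
    by apply/eqP; field.
  by move: X Y EE => X Y EE; rewrite !hornerE EE -aq /=; ring.
have [X0 Y0] : X = 0 /\ Y = 0.
  by apply: sqr_eq_irreducible_mul irr_q _; apply/eqP; rewrite -subr_eq0 XY.
(* Otherwise [q] would be constant. *)
have qC0 : q + C ^+ 2 != 0.
  apply: contraTneq q1 => /eqP; rewrite addr_eq0 => /eqP ->.
  by rewrite size_polyN -polyC_exp size_polyC; case: (_ == _).
(* [X] and [Y] are linear in [K] and [N]; this combination of them cancels [N]. *)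
have : (K * C * (q + C ^+ 2)) * (q * (q - 3 * C ^+ 2) + C ^+ 4) = 0.
  have -> : K * C * (q + C ^+ 2) * (q * (q - 3 * C ^+ 2) + C ^+ 4) =
    2 * C * (q - C ^+ 2) * X - (q ^+ 2 - C ^+ 2 * q + C ^+ 4) * Y.
    by rewrite /X /Y; ring.
  by rewrite X0 Y0 !mulr0 subr0.
move/eqP; rewrite !mulf_eq0 (negPf K0) (negPf C0) (negPf qC0) /=.
rewrite addr_eq0 => /eqP E.
(* A polynomial of positive degree would divide a nonzero constant. *)
have : q %| - C ^+ 4 by rewrite -E dvdp_mulr.
rewrite -polyC_exp dvdpNr => /dvdp_leq.
rewrite polyC_eq0 expf_eq0 (negPf c0) => /(_ isT).
by rewrite size_polyC expf_eq0 c0 /= leqNgt q1.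
Qed.

(** * Rational functions of one variable and restriction to a line *)

Definition ratfun_on (R : realType) (T : set R) (f : R -> R) : Prop :=
  exists N D : {poly R}, forall t, T t -> D.[t] != 0 /\ f t = N.[t] / D.[t].

Section RationalFunctions.
Variables (R : realType) (T : set R).
Implicit Types f g : R -> R.

Lemma ratfun_add f g :
  ratfun_on T f -> ratfun_on T g -> ratfun_on T (fun t => f t + g t).
Proof.
move=> [N [D fE]] [N' [D' gE]]; exists (N * D' + N' * D), (D * D') => t Tt.
have [D0 ->] := fE t Tt; have [D'0 ->] := gE t Tt.
split; first by rewrite hornerM mulf_neq0.
by rewrite !hornerE /=; field; rewrite D0 D'0.
Qed.

Lemma ratfun_mul f g :
  ratfun_on T f -> ratfun_on T g -> ratfun_on T (fun t => f t * g t).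
Proof.
move=> [N [D fE]] [N' [D' gE]]; exists (N * N'), (D * D') => t Tt.
have [D0 ->] := fE t Tt; have [D'0 ->] := gE t Tt.
split; first by rewrite hornerM mulf_neq0.
by rewrite !hornerE /=; field; rewrite D0 D'0.
Qed.

Lemma ratfun_sum n (f : 'I_n -> R -> R) : (forall i, ratfun_on T (f i)) ->
  ratfun_on T (fun t => \sum_(i < n) f i t).
Proof.
elim: n f => [|n IH] f fT.
  by exists 0, 1 => t _; rewrite big_ord0 hornerC oner_neq0 horner0 mul0r.
have [N [D E]] :=
  ratfun_add (IH _ (fun i => fT (widen_ord (leqnSn n) i))) (fT ord_max).
by exists N, D => t Tt; rewrite big_ord_recr; exact: E.
Qed.

(** Substituting the affine coordinates of the line into a multivariate polynomial, monomial by
    monomial, yields a univariate one. *)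
Lemma ratfun_line n (A : set 'rV[R]_n) (f : 'rV[R]_n -> R) (x v : 'rV[R]_n) :
  (forall t, T t -> A (t *: v + x)) ->
  rational_on A f -> ratfun_on T (fun t => f (t *: v + x)).
Proof.
move=> TA [P [Q fE]].
have line (p : mpoly.mpoly n R) :
    exists r : {poly R}, forall t, r.[t] = mpoly.meval ((t *: v + x) 0) p.
  exists (\sum_(m <- mpoly.msupp p) (mpoly.mcoeff m p)%:P *
    \prod_(i < n) ((v 0 i)%:P * 'X + (x 0 i)%:P)
      ^+ (mpoly.fun_of_multinom m i)) => t.
  rewrite mpoly.mevalE horner_sum; apply: eq_bigr => m _.
  rewrite hornerM hornerC horner_prod; congr (_ * _); apply: eq_bigr => i _.
  by rewrite !hornerE !mxE mulrC.
have [N NE] := line P; have [D DE] := line Q.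
by exists N, D => t /TA/fE; rewrite NE DE.
Qed.

Lemma ratfun_form n (a : R -> 'M[R]_n) (y z : R -> 'rV[R]_n) :
  (forall i j, ratfun_on T (fun t => a t i j)) ->
  (forall i, ratfun_on T (fun t => y t 0 i)) ->
  (forall i, ratfun_on T (fun t => z t 0 i)) ->
  ratfun_on T (fun t => (y t *m a t *m (z t)^T) 0 0).
Proof.
move=> aT yT zT.
have /(_ _)[|N [D E]] := @ratfun_sum n
  (fun j t => (\sum_i y t 0 i * a t i j) * z t 0 j).
  move=> j; apply: ratfun_mul => //; apply: (@ratfun_sum n) => i.
  exact: ratfun_mul.
exists N, D => t Tt; have [D0 <-] := E t Tt; split=> //.
by rewrite mxE; apply: eq_bigr => j _; rewrite !mxE.
Qed.

End RationalFunctions.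

(** * Positive definite forms and the kernel of a covector *)

Section PositiveDefinite.
Variables (R : realType) (n : nat) (A : 'M[R]_n) (b : 'rV[R]_n).
Hypothesis posA : sym_posdef A.

Lemma posdef_unitmx : A \in unitmx.
Proof.
have [_ pA] := posA.
rewrite -row_free_unit -kermx_eq0; apply/rowV0P => u /sub_kermxP uA.
by apply/eqP; apply: contraT => /pA; rewrite /quad uA mul0mx mxE ltxx.
Qed.

Lemma bil_dual u : bil A (b *m invmx A) u = covec b u.
Proof.
rewrite /bil mulmxKV ?posdef_unitmx// /covec.
by rewrite -[in LHS](trmxK b) -trmx_mul [LHS]mxE.
Qed.

Lemma covec_dual : covec b (b *m invmx A) = quad (invmx A) b.
Proof. by []. Qed.

(** The witness is ||b||^2 times the A-orthogonal projection of [y] onto the kernel of [b]. *)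
Lemma exists_transverse_kernel y : y != 0 -> 0 < quad (invmx A) b ->
  covec b y ^+ 2 < quad (invmx A) b * quad A y ->
  exists2 v, v != 0 & covec b v = 0.
Proof.
move=> y0 N0 lt; set w := b *m invmx A.
(* The hypothesis is a strict Cauchy-Schwarz inequality, so y is not parallel
   to w, the A-dual of b. *)
exists (quad (invmx A) b *: y - covec b y *: w); last first.
  rewrite -scaleNr covecD !covecZ covec_dual; ring.
apply/eqP => /eqP; rewrite subr_eq0 => /eqP E.
have := congr1 (fun u => bil A u y) E.
rewrite !bilZl bil_dual -quadE -expr2 => E'.
by rewrite E' ltxx in lt.
Qed.

Definition quad_line (y v : 'rV[R]_n) : {poly R} :=
  ((bil A v v)%:P * 'X + (2 * bil A y v)%:P) * 'X + (bil A y y)%:P.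

Lemma horner_quad_line y v t : (quad_line y v).[t] = quad A (t *: v + y).
Proof.
have [symA _] := posA.
rewrite /quad_line !hornerE quadE bilDl !bilDr !bilZl !bilZr (bilC symA v y).
ring.
Qed.

(** A quadratic without real root: [b] keeps the nonzero value b(y) on the line, which therefore
    avoids the origin, and [A] is positive there. *)
Lemma irreducible_quad_line y v : v != 0 -> covec b v = 0 -> covec b y != 0 ->
  irreducible_poly (quad_line y v).
Proof.
move=> v0 bv0 by0; have [_ pA] := posA.
have vv0 : bil A v v != 0 by rewrite -quadE lt0r_neq0// pA.
apply: cubic_irreducible => [|t].
  have p0 : (bil A v v)%:P * 'X + (2 * bil A y v)%:P != 0.
    by rewrite -size_poly_gt0 size_MXaddC polyC_eq0 (negPf vv0).
  rewrite size_MXaddC (negPf p0) size_MXaddC polyC_eq0 (negPf vv0).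
  by rewrite size_polyC vv0.
rewrite /root horner_quad_line lt0r_neq0// pA//.
have E : covec b (t *: v + y) = covec b y.
  by rewrite covecD covecZ bv0 mulr0 add0r.
by apply: contraNneq by0 => y0; rewrite -E y0 /covec mul0mx mxE.
Qed.

End PositiveDefinite.

(** * The contradiction in one tangent space *)

Section GoldenCone.
Variables (R : realType) (n : nat) (A : 'M[R]_n) (b : 'rV[R]_n).
Hypothesis posA : sym_posdef A.
Let N : R := quad (invmx A) b.

Definition golden_slope (s : R) : Prop :=
  (- golden_radius (Num.sqrt N) < s < (1 - Num.sqrt 5) / 2) \/
  ((1 + Num.sqrt 5) / 2 < s < golden_radius (Num.sqrt N)).

Hypothesis normb : 1 / Num.sqrt 2 < Num.sqrt N.

Lemma dual_norm_gt : 1 < 2 * N.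
Proof.
have s2 : 0 < Num.sqrt (2 : R) by rewrite sqrtr_gt0.
(* [Num.sqrt] is 0 on negative reals, so a positive root forces [N] to be positive. *)
have N0 : 0 < N by rewrite -sqrtr_gt0 (lt_trans _ normb)// divr_gt0.
have := normb; rewrite ltr_pdivrMr// => lt.
have : 1 < (Num.sqrt N * Num.sqrt 2) ^+ 2.
  by rewrite expr_gt1// mulr_ge0// sqrtr_ge0.
by rewrite exprMn !sqr_sqrtr// ?ltW// mulrC.
Qed.

Lemma golden_slope_neq0 s : golden_slope s -> s != 0.
Proof.
have : 1 < Num.sqrt (5 : R) by rewrite -[ltLHS]sqrtr1 ltr_sqrt// ltr1n.
move=> s5 [] /andP[h1 h2]; [rewrite lt_eqF//|rewrite gt_eqF//]; lra.
Qed.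

(** In both intervals |s| < k, and k^2 = (2 N - 1) / 3 < N. This supplies the strict inequality of
    [exists_transverse_kernel]. *)
Lemma golden_slope_sqr s : golden_slope s -> s ^+ 2 < N.
Proof.
have N1 := dual_norm_gt.
have : 1 < Num.sqrt (5 : R) by rewrite -[ltLHS]sqrtr1 ltr_sqrt// ltr1n.
rewrite /golden_slope; set k := golden_radius _ => s5 gs.
have k2 : k ^+ 2 = (2 * N - 1) / 3.
  by rewrite /k /golden_radius !sqr_sqrtr//; lra.
have k0 : 0 <= k by exact: sqrtr_ge0.
have : s ^+ 2 < k ^+ 2 by case: gs => /andP[h1 h2]; nra.
rewrite k2; lra.
Qed.

Lemma near_golden_slope (T : topologicalType) (F : set_system T) {FF : Filter F}
    (f : T -> R) s : f @ F --> s -> golden_slope s ->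
  \forall t \near F, golden_slope (f t).
Proof.
move=> fs [] /andP[h1 h2]; near=> t; [left|right].
- apply/andP; split; near: t; [exact: (cvgr_gt s)|exact: (cvgr_lt s)].
- apply/andP; split; near: t; [exact: (cvgr_gt s)|exact: (cvgr_lt s)].
Unshelve. all: by end_near. Qed.

Lemma golden_cone_not_rational (y : 'rV[R]_n) (Dom : set 'rV[R]_n)
    (eta : 'rV[R]_n -> R) (a : 'rV[R]_n -> 'M[R]_n) :
  Dom = [set y | y != 0 /\ golden_slope (covec b y / Num.sqrt (quad A y))] ->
  Dom y ->
  (forall y, Dom y -> sym_posdef (a y)) ->
  (forall i j, rational_on Dom (fun y => a y i j)) ->
  (forall y, Dom y -> energy_hess A b y = eta y *: a y) -> False.
Proof.
move=> DomE Dy apos arat hess; have [symA pA] := posA.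
have [y0 gs] : y != 0 /\ golden_slope (covec b y / Num.sqrt (quad A y)).
  by move: Dy; rewrite DomE.
have by0 : covec b y != 0.
  by apply: contraNneq (golden_slope_neq0 gs) => ->; rewrite mul0r.
have normN := dual_norm_gt.
have [v v0 bv0] : exists2 v, v != 0 & covec b v = 0.
  apply: (exists_transverse_kernel posA y0); rewrite -/N; first lra.
  have := golden_slope_sqr gs; rewrite expr_div_n sqr_sqrtr ?ltW ?pA//.
  by rewrite ltr_pdivrMr ?pA.
pose l t : 'rV[R]_n := t *: v + y.
have bl t : covec b (l t) = covec b y by rewrite covecD covecZ bv0 mulr0 add0r.
have l0 t : l t != 0.
  by apply: contraNneq by0 => lt0; rewrite -(bl t) lt0 /covec mul0mx mxE.
pose T : set R := [set t | Dom (l t)].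
have nT : \forall t \near (0 : R), T t.
  rewrite /T DomE /=.
  have : \forall t \near (0 : R),
      golden_slope (covec b y / Num.sqrt (quad A (l t))).
    apply: (@near_golden_slope _ (nbhs (0 : R)) _ _ _ _ gs).
    apply: cvgM; first exact: cvg_cst.
    (* Continuity of 1 / alpha along the line at 0 comes from its derivability along [v]. *)
    have /is_derive_lineP[/derivable1_diffP/differentiable_continuous C _] :=
      is_derive_alV posA v y0.
    have <- : l 0 = y by rewrite /l scale0r add0r.
    exact: C.
  by apply: filterS => t; rewrite -(bl t).
have lrat i : ratfun_on T (fun t => l t 0 i).
  exists ((v 0 i)%:P * 'X + (y 0 i)%:P), 1 => t _.
  by rewrite hornerC oner_neq0 divr1 !hornerE !mxE mulrC.
have vrat i : ratfun_on T (fun=> v 0 i).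
  by exists (v 0 i)%:P, 1 => t _; rewrite !hornerC oner_neq0 divr1.
have art i j : ratfun_on T (fun t => a (l t) i j).
  by exact: ratfun_line (arat i j).
(* N1 / D1 is a(y,v) and N2 / D2 is a(y,y) at the point [l t]. *)
have [N1 [D1 E1]] := ratfun_form art lrat vrat.
have [N2 [D2 E2]] := ratfun_form art lrat lrat.
pose K := ((bil A v v)%:P * 'X + (bil A y v)%:P) * N2 * D1.
have T0 : T 0 by exact: nbhs_singleton nT.
(* The linear factor has leading coefficient A(v,v) > 0, [N2] is nonzero at 0 because [a] is
   positive definite there, and [D1] is a denominator. *)
have K0 : K != 0.
  have [D10 _] := E1 _ T0; have [_] := E2 _ T0.
  have [_ /(_ _ (l0 0))] := apos _ T0; rewrite /quad => + e2; rewrite e2 => p2.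
  rewrite !mulf_neq0//.
  - rewrite -size_poly_gt0 size_MXaddC polyC_eq0.
    by rewrite -[bil A v v]/(quad A v) gt_eqF// pA.
  - by apply: contraTneq p2 => ->; rewrite horner0 mul0r ltxx.
  - by apply: contraNneq D10 => ->; rewrite horner0.
apply: (@no_rational_ratio R (quad_line A y v) K (N1 * D2) (covec b y)) => //.
  exact: irreducible_quad_line by0.
apply: filterS nT => t Tt; rewrite horner_quad_line//.
split; first exact: pA (l0 t).
have [D10 e1] := E1 t Tt; have [D20 e2] := E2 t Tt.
have scale11 k (p : 'M[R]_1) : (k *: p) 0 0 = k * p 0 0 by rewrite mxE.
(* Euler's theorem evaluates eta a(y,v) and eta a(y,y); cross multiplication then eliminates eta.
   The term in b(v) vanishes. *)
have := euler_hess b posA v (l0 t).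
have := euler_hess b posA (l t) (l0 t).
rewrite -energy_euler// (hess _ Tt) -!scalemxAr -!scalemxAl !scale11.
rewrite e1 e2 energyE// /energy_q -/(covec b _) bl bv0 mulr0 addr0 => h2 h1 /=.
have KE : K.[t] = bil A (l t) v * N2.[t] * D1.[t].
  by rewrite /K !hornerE /l bilDl bilZl /=; ring.
rewrite KE hornerM.
set en := (X in _ = 2 * X * _); set ev := (X in X * _ = _).
have {}h1 : ev * bil A (l t) v = 2 * (eta (l t) * (N1.[t] / D1.[t])).
  by rewrite h1 -/ev; field.
rewrite !mulrA h1 /en -h2; field; by rewrite D10 D20.
Qed.
End GoldenCone.

Theorem theorem2p10 (R : realType) (n : nat) (M : manifold R n) :
  ~ exists G : golden_metric M, almost_rational (golden_domain G) (golden_F G).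
Proof.
move=> [G [eta [a [_ apos arat hess]]]].
(* The nonempty domain supplies the tangent space and the vector at which the argument starts. *)
have [c [x [y Dy]]] := golden_set_neq0 G.
have cx : chart_image c x by case: Dy.
have pos := metric_posdef (golden_alpha G) cx.
apply: (@golden_cone_not_rational R n _ _ pos (golden_norm_gt G cx) y
  [set y | golden_domain G c x y] (eta c x) (a c x)) => //.
- apply/seteqP; split=> z /=; first by case.
  by case=> z0 gs; split.
- by move=> z; exact: apos.
- by move=> z; exact: hess.
Qed.
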